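(* Let $Z$ be a set of double points in $\mathbb{P}^1\times\mathbb{P}^1$ with ACM support $X$, let $\lambda=(\lambda_1,\ldots,\lambda_r)=\alpha_X$, and let $\mathcal{C}$, $p=|\mathcal{C}|$, $F_\ell$, $I_\ell$ and $\mathcal{M}_\ell$ be as defined in the context. Let $1\le\ell\le p$ and let $(i,j)=(i_\ell,j_\ell)$ be the $\ell$th corner in $\mathcal{C}$. Then $$(I_{\ell-1}:F_\ell)=I_{CI(a_{i,j},b_{i,j})},$$ i.e. $(I_{\ell-1}:F_\ell)$ is the defining ideal of a complete intersection of points of type $(a_{i,j},b_{i,j})$, where $a_{i,j}=m_{i,j}+\cdots+m_{r,j}$, $b_{i,j}=m_{i,j}+\cdots+m_{i,\lambda_1}$ and $m_{a,b}=(\mathcal{M}_{\ell-1})_{a,b}$.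
   Context: $k$ is an algebraically closed field of characteristic zero, and $S=k[x_0,x_1,y_0,y_1]$ is $\mathbb{N}^2$-graded with $\deg x_i=(1,0)$, $\deg y_i=(0,1)$; it is the coordinate ring of $\mathbb{P}^1\times\mathbb{P}^1$. A point $P=R\times Q\in\mathbb{P}^1\times\mathbb{P}^1$ has defining ideal $I_P=(L_R,L_Q)$, where $L_R$ (degree $(1,0)$) and $L_Q$ (degree $(0,1)$) are linear forms vanishing at $R$, resp. $Q$. For a finite set $X$ of points with positive multiplicities $m_P$, the fat point scheme $\{(P;m_P)\}$ has defining ideal $\bigcap_{P\in X}I_P^{m_P}$ and support $X$; it is a set of double points if all $m_P=2$. A set of points $X$ with defining ideal $I_X$ is arithmetically Cohen-Macaulay (ACM) if $S/I_X$ is Cohen-Macaulay. For a finite set of points $X$, let $\pi_1,\pi_2$ be the projections to the two factors, $\pi_1(X)=\{R_1,\ldots,R_r\}$, $\pi_2(X)=\{Q_1,\ldots,Q_t\}$. The partition $\alpha_X$ lists the numbers $|\{P\in X : \pi_1(P)=R_i\}|$, $i=1,\dots,r$, in non-increasing order. A (reduced) set of points $C$ is a complete intersection of type $(a,b)$, written $C=CI(a,b)$, if $C=\{R\times Q : R\in\pi_1(C),Q\in\pi_2(C)\}$ with $|\pi_1(C)|=a$, $|\pi_2(C)|=b$; then $I_C=\bigl(\prod_{R\in\pi_1(C)}L_R,\ \prod_{Q\in\pi_2(C)}L_Q\bigr)$. Let $Z$ be a set of double points with ACM support $X$ and $\lambda=(\lambda_1,\ldots,\lambda_r)=\alpha_X$.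 Then $t=\lambda_1$, and one relabels the $R_i$ and $Q_j$ so that $X=\{R_i\times Q_j : 1\le i\le r,\ 1\le j\le\lambda_i\}$ (always possible when $X$ is ACM). The completion of $Z$ is $Y=Z\cup(W\setminus X)$, where $W=\{R_i\times Q_j : 1\le i\le r,1\le j\le \lambda_1\}$; i.e. $Y$ has multiplicity $2$ at points of $X$ and $1$ at points of $W\setminus X$, with defining ideal $I_Y$. The degree matrix $\mathcal{M}_\lambda$ is the $r\times\lambda_1$ matrix with $(\mathcal{M}_\lambda)_{i,j}=2$ if $j\le\lambda_i$ and $1$ otherwise. The base corners are $\mathcal{C}_0=\{(i,j) : (\mathcal{M}_\lambda)_{i,j}=1,\ (\mathcal{M}_\lambda)_{i-1,j}=(\mathcal{M}_\lambda)_{i,j-1}=2\}$ (equivalently $\{(i,\lambda_i+1) : 2\le i\le r,\ \lambda_i<\lambda_{i-1}\}$); $\mathcal{C}_1=\{(i,l) : (i,j),(k,l)\in\mathcal{C}_0,\ i>k\}$; the corners are $\mathcal{C}=\mathcal{C}_0\cup\mathcal{C}_1=\{(i_1,j_1),\ldots,(i_p,j_p)\}$, ordered from largest to smallest in lexicographic order. The form relative to the corner $(i,j)=(i_\ell,j_\ell)$ is $$F_\ell=L_{R_1}^{n_{1,j}}\cdots L_{R_{i-1}}^{n_{i-1,j}}L_{Q_1}^{n_{i,1}}\cdots L_{Q_{j-1}}^{n_{i,j-1}},\qquad n_{a,b}=(\mathcal{M}_\lambda)_{a,b}.$$ Set $I_0=I_Y$ and $I_\ell=(I_{\ell-1},F_\ell)$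 for $\ell=1,\ldots,p$. Let $\succeq$ be the partial order with $(a,b)\succeq(c,d)$ iff $a\ge c$ and $b\ge d$. Set $\mathcal{M}_0=\mathcal{M}_\lambda$ and, for $\ell=1,\ldots,p$, let $\mathcal{M}_\ell$ be the $r\times\lambda_1$ matrix with $(\mathcal{M}_\ell)_{a,b}=0$ if $(a,b)\succeq(i_\ell,j_\ell)$ and $(\mathcal{M}_\ell)_{a,b}=(\mathcal{M}_{\ell-1})_{a,b}$ otherwise. *)

(* Defs.v *)
From HB Require Import structures.
From mathcomp Require Import all_boot all_order all_algebra.
From mathcomp Require Import generic_quotient finmap mpoly.

Set Implicit Arguments.
Unset Strict Implicit.
Unset Printing Implicit Defensive.

Import GRing.Theory.
Local Open Scope ring_scope.

Record nzpair (k : fieldType) := NzPair {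
  coords :> k * k;
  _ : coords != (0, 0)
}.

HB.instance Definition _ (k : fieldType) := [isSub for @coords k].
HB.instance Definition _ (k : fieldType) := [Choice of nzpair k by <:].

Definition proportional (k : fieldType) (u v : nzpair k) : bool :=
  u.1 * v.2 == u.2 * v.1.

Lemma proportionalP (k : fieldType) (u v : nzpair k) :
  reflect (exists2 c : k, c != 0 & (u : k * k) = (c * v.1, c * v.2))
          (proportional u v).
Proof.
case: u v => [[a b] /= nz_u] [[c d] /= nz_v]; rewrite /proportional /=.
apply: (iffP eqP) => [eq_uv | [e _ [-> ->]]]; last by rewrite mulrAC.
have nzS (x y : k) : (x, y) != (0, 0) -> x == 0 -> y != 0.
  by move=> nz_xy /eqP xE; apply: contraNneq nz_xy => yE; rewrite xE yE.
have [c0 | c_neq0] := boolP (c == 0).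
  have d_neq0 := nzS _ _ nz_v c0; move/eqP: c0 => c0.
  have a0 : a = 0.
    by move/eqP: eq_uv; rewrite c0 mulr0 mulf_eq0 (negPf d_neq0) orbF => /eqP.
  exists (b / d); last by rewrite c0 mulr0 divfK // a0.
  have b_neq0 : b != 0 by apply: (nzS a) => //; rewrite a0 eqxx.
  by rewrite mulf_neq0 ?invr_eq0.
have eq_b : b = a / c * d by rewrite mulrAC eq_uv mulfK.
exists (a / c); last by rewrite divfK // -eq_b.
rewrite mulf_neq0 ?invr_eq0 //; apply: contraNneq nz_u => a0.
by rewrite eq_b a0 !mul0r.
Qed.

Lemma proportional_refl (k : fieldType) : reflexive (@proportional k).
Proof. by move=> u; rewrite /proportional mulrC. Qed.

Lemma proportional_sym (k : fieldType) : ssrbool.symmetric (@proportional k).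
Proof.
by move=> u v; rewrite /proportional eq_sym; congr (_ == _); apply: mulrC.
Qed.

Lemma proportional_trans (k : fieldType) : transitive (@proportional k).
Proof.
move=> v u w /proportionalP[c c0 def_u] /proportionalP[d d0 def_v].
apply/proportionalP; exists (c * d); first by rewrite mulf_neq0.
by rewrite def_u def_v /= !mulrA.
Qed.

Canonical proportional_equiv (k : fieldType) :=
  EquivRel (@proportional k) (@proportional_refl k) (@proportional_sym k)
           (@proportional_trans k).

Definition pline (k : fieldType) : Type :=
  {eq_quot (@proportional_equiv k)}%qT.

HB.instance Definition _ (k : fieldType) := Choice.on (pline k).
HB.instance Definition _ (k : fieldType) := Quotient.on (pline k).

Definition point (k : fieldType) : Type := (pline k * pline k)%type.

HB.instance Definition _ (k : fieldType) := Choice.on (point k).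

Notation coordring k := {mpoly k[4]}.

Definition x0 (k : fieldType) : coordring k := 'X_(@Ordinal 4 0 isT).
Definition x1 (k : fieldType) : coordring k := 'X_(@Ordinal 4 1 isT).
Definition y0 (k : fieldType) : coordring k := 'X_(@Ordinal 4 2 isT).
Definition y1 (k : fieldType) : coordring k := 'X_(@Ordinal 4 3 isT).

(* For R = [a : b], the form b x0 - a x1; it is determined by R up to a
   nonzero scalar, which is fixed by the choice of a representative of R. *)
Definition LR (k : fieldType) (R : pline k) : coordring k :=
  (repr R).2 *: x0 k - (repr R).1 *: x1 k.

Definition LQ (k : fieldType) (Q : pline k) : coordring k :=
  (repr Q).2 *: y0 k - (repr Q).1 *: y1 k.

(* Ideals are Prop-valued predicates: the library's idealr is restricted to
   decidable proper ideals. *)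
Section Ideals.

Variable S : comNzRingType.
Implicit Types (A I J P : S -> Prop) (f g h : S).

Definition is_ideal I : Prop :=
  [/\ I 0, forall f g, I f -> I g -> I (f + g) & forall f g, I g -> I (f * g)].

Definition is_prime_ideal P : Prop :=
  [/\ is_ideal P, ~ P 1 & forall f g, P (f * g) -> P f \/ P g].

Definition ideal_gen A : S -> Prop :=
  fun f => forall I, is_ideal I -> (forall g, A g -> I g) -> I f.

Definition ideal_mul I J : S -> Prop :=
  ideal_gen (fun h => exists f g, [/\ I f, J g & h = f * g]).

Fixpoint ideal_exp I (n : nat) : S -> Prop :=
  if n is n'.+1 then ideal_mul I (ideal_exp I n') else fun=> True.

Definition ideal_adjoin I f : S -> Prop :=
  ideal_gen (fun g => I g \/ g = f).

Definition ideal_colon I f : S -> Prop := fun g => I (g * f).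

Definition prime_chain I (n : nat) : Prop :=
  exists P : nat -> S -> Prop,
    [/\ forall i, (i <= n)%N -> is_prime_ideal (P i),
        forall i, (i <= n)%N -> forall f, I f -> P i f
      & forall i, (i < n)%N ->
          (forall f, P i f -> P i.+1 f) /\ (exists f, P i.+1 f /\ ~ P i f)].

(* d is the Krull dimension of S / I. *)
Definition krull_dim I (d : nat) : Prop :=
  prime_chain I d /\ forall n, prime_chain I n -> (n <= d)%N.

Fixpoint regular_seq I (s : seq S) : Prop :=
  if s is f :: s' then
    (forall g, I (g * f) -> I g) /\ regular_seq (ideal_adjoin I f) s'
  else ~ I 1.

(* d is the depth of S / I with respect to the ideal M. *)
Definition depth M I (d : nat) : Prop :=
  (exists s : seq S, [/\ forall f, f \in s -> M f, regular_seq I s & size s = d])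
  /\ (forall s : seq S, (forall f, f \in s -> M f) -> regular_seq I s ->
      (size s <= d)%N).

End Ideals.

Definition irrelevant (k : fieldType) : coordring k -> Prop :=
  ideal_gen (fun f => [\/ f = x0 k, f = x1 k, f = y0 k | f = y1 k]).

(* For a homogeneous ideal I: depth is measured at the irrelevant maximal
   ideal, as usual for graded rings. *)
Definition CM_quotient (k : fieldType) (I : coordring k -> Prop) : Prop :=
  exists d, krull_dim I d /\ depth (@irrelevant k) I d.

Local Open Scope fset_scope.

(* The multiplicity function; its support finsupp Z is the support of Z. *)
Notation fat_points k := {fsfun point k -> nat with 0%N}.

Definition point_ideal (k : fieldType) (P : point k) : coordring k -> Prop :=
  ideal_gen (fun f => f = LR P.1 \/ f = LQ P.2).

Definition fat_ideal (k : fieldType) (Z : fat_points k) : coordring k -> Prop :=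
  fun f => forall P, P \in finsupp Z -> ideal_exp (point_ideal P) (Z P) f.

Definition points_ideal (k : fieldType) (X : {fset point k}) :
    coordring k -> Prop :=
  fun f => forall P, P \in X -> point_ideal P f.

Definition double_points (k : fieldType) (Z : fat_points k) : Prop :=
  forall P, P \in finsupp Z -> Z P = 2%N.

Definition ACM (k : fieldType) (X : {fset point k}) : Prop :=
  CM_quotient (points_ideal X).

Definition pi1 (k : fieldType) (X : {fset point k}) : {fset pline k} :=
  [fset P.1 | P in X].

Definition pi2 (k : fieldType) (X : {fset point k}) : {fset pline k} :=
  [fset P.2 | P in X].

Definition alpha (k : fieldType) (X : {fset point k}) : seq nat :=
  sort geq [seq #|` [fset P in X | P.1 == R]| | R <- enum_fset (pi1 X)].

Definition is_CI (k : fieldType) (C : {fset point k}) (a b : nat) : Prop :=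
  [/\ C = pi1 C `*` pi2 C, #|` pi1 C| = a & #|` pi2 C| = b].

(* R and Q enumerate pi1(X) and pi2(X) in such a way that
   X = {R_i x Q_j : j <= lambda_i}; indices start from 0 here. *)
Definition ferrers_labelling (k : fieldType) (X : {fset point k})
    (lam : seq nat) (R : 'I_(size lam) -> pline k)
    (Q : 'I_(head 0%N lam) -> pline k) : Prop :=
  [/\ injective R /\ (forall A, A \in pi1 X <-> exists i, A = R i),
      injective Q /\ (forall B, B \in pi2 X <-> exists j, B = Q j)
    & forall P : point k, P \in X <->
        exists (i : 'I_(size lam)) (j : 'I_(head 0%N lam)),
          (j < nth 0%N lam i)%N /\ P = (R i, Q j)].

(* The set W is pi1(X) x pi2(X). *)
Definition completion (k : fieldType) (Z : fat_points k) : fat_points k :=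
  [fsfun P in pi1 (finsupp Z) `*` pi2 (finsupp Z) =>
     if P \in finsupp Z then Z P else 1%N].

(* Rows and columns are indexed from 0 throughout. *)
Definition degree_mx (lam : seq nat) : 'M[nat]_(size lam, head 0%N lam) :=
  \matrix_(i, j) if (j < nth 0%N lam i)%N then 2%N else 1%N.

Section Corners.

Variables (r t : nat).
Implicit Types (M : 'M[nat]_(r, t)) (c d : 'I_r * 'I_t).

Definition base_corners M : {set 'I_r * 'I_t} :=
  [set c | [&& M c.1 c.2 == 1%N,
               [exists i : 'I_r, (i.+1 == c.1 :> nat) && (M i c.2 == 2%N)]
             & [exists j : 'I_t, (j.+1 == c.2 :> nat) && (M c.1 j == 2%N)]]].

Definition derived_corners M : {set 'I_r * 'I_t} :=
  [set (c.1, d.2) | c in base_corners M, d in base_corners M & (d.1 < c.1)%N].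

Definition lex_geq c d : bool :=
  (d.1 < c.1)%N || ((c.1 == d.1) && (d.2 <= c.2)%N).

Definition corner_seq M : seq ('I_r * 'I_t) :=
  sort lex_geq (enum (base_corners M :|: derived_corners M)%SET).

Definition zero_from M c : 'M[nat]_(r, t) :=
  \matrix_(a, b) if (c.1 <= a)%N && (c.2 <= b)%N then 0%N else M a b.

(* M_l, obtained from M = M_0 by using the first l corners *)
Definition corner_mx M (l : nat) : 'M[nat]_(r, t) :=
  foldl zero_from M (take l (corner_seq M)).

Variable k : fieldType.
Variables (R : 'I_r -> pline k) (Q : 'I_t -> pline k).

Definition corner_form M c : coordring k :=
  (\prod_(a < r | (a < c.1)%N) LR (R a) ^+ M a c.2) *
  (\prod_(b < t | (b < c.2)%N) LQ (Q b) ^+ M c.1 b).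

(* I_l, obtained from I0 by adjoining the forms of the first l corners *)
Definition corner_ideal M (I0 : coordring k -> Prop) (l : nat) :
    coordring k -> Prop :=
  foldl (fun I c => ideal_adjoin I (corner_form M c)) I0
        (take l (corner_seq M)).

End Corners.

(* Main.v *)
From HB Require Import structures.
Require Import Defs.
From mathcomp Require Import all_boot all_order all_algebra.
From mathcomp Require Import generic_quotient finmap mpoly ring zify.

Set Implicit Arguments.
Unset Strict Implicit.
Unset Printing Implicit Defensive.

(** Write M_l for the degree matrix after the first l corners, and let
    (i, j) be the next corner.  Two facts give the theorem.

    - I_l is the ideal of the fat points R_a x Q_b with multiplicities M_l
      ([corner_idealE]).
    - Passing from M_l to M_(l+1) deletes a rectangular block C of simple
      points, whose rows and columns are those a >= i, b >= j at which the
      column j, resp. the row i, of M_l does not vanish.  The form F of the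
      corner does not vanish on C, and at every other point it vanishes to
      order at least M_l ([corner_mx_step], a computation with partitions).

    The second fact gives (I_l : F) = I_C, one point at a time
    ([colon_corner]); the sums of the column j and of the row i of M_l count
    the rows and the columns of C.

    The first fact is proved by induction: if f vanishes to the orders
    M_(l+1), then f - h F vanishes on C for some h ([adjoin_corner]).  Write
    F = U V, where U is a product of forms L_R and V a product of forms L_Q,
    and let A and B be the products of the L_R over the rows of C and of the
    L_Q over its columns, so that I_C = (A, B).  On each row of C the form f
    vanishes at the points that V cuts out there, to the orders prescribed by
    V, hence f is in (A, V); in the same way f is in (B, U)
    ([ideal_span_grid]).  Now A, U, B, V is a regular sequence: if
    f = p A + q V is in (B, U), then V q is in (A, U, B), hence q is in
    (A, U, B), and so f is in (U V, A, B) ([ideal_span_corner]).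

    The regularity of sequences of products follows from that of the
    sequences formed by one factor of each product ([nzd_prods]).  For linear
    forms it is linear algebra: a form that is nonzero at a common zero of
    other forms is a nonzerodivisor modulo them ([nzd_linear_form]). *)

(** * Ideals, nonzerodivisors and regular sequences *)

Section IdealTheory.

Import GRing.Theory.
Local Open Scope ring_scope.

Variable S : comNzRingType.
Implicit Types (A I J : S -> Prop) (f g h p : S) (s c d : seq S)
               (ss : seq (seq S)).

Lemma ideal_gen_ideal A : is_ideal (ideal_gen A).
Proof.
split=> [I [] // | f g If Ig I idI sub | f g Ig I idI sub]; case: (idI).
  by move=> _ add _; apply: add; [apply: If | apply: Ig].
by move=> _ _ mul; apply: mul; apply: Ig.
Qed.

Lemma ideal_gen_sub A f : A f -> ideal_gen A f.
Proof. by move=> Af I _; apply. Qed.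

Lemma is_ideal0 I : is_ideal I -> I 0. Proof. by case. Qed.

Lemma is_idealD I f g : is_ideal I -> I f -> I g -> I (f + g).
Proof. by case=> _ + _; apply. Qed.

Lemma is_idealMl I f g : is_ideal I -> I g -> I (f * g).
Proof. by case=> _ _; apply. Qed.

Lemma is_idealMr I f g : is_ideal I -> I f -> I (f * g).
Proof. by rewrite mulrC; apply: is_idealMl. Qed.

Lemma is_idealB I f g : is_ideal I -> I f -> I g -> I (f - g).
Proof.
by move=> idI If Ig; rewrite -mulN1r; apply: (is_idealD idI If);
  apply: is_idealMl.
Qed.

Lemma ideal_adjoinP I f g :
  is_ideal I -> ideal_adjoin I f g <-> exists h, I (g - h * f).
Proof.
move=> idI; split=> [Jg|[h Igh]].
  apply: (Jg (fun e => exists h, I (e - h * f))) => [|e [Ie | ->]].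
  - split=> [|e1 e2 [h1 I1] [h2 I2] | e1 e2 [h I2]].
    + by exists 0; rewrite mul0r subr0; apply: (is_ideal0 idI).
    + by exists (h1 + h2); rewrite mulrDl opprD addrACA; apply: (is_idealD idI).
    by exists (e1 * h); rewrite -mulrA -mulrBr; apply: (is_idealMl _ idI).
  - by exists 0; rewrite mul0r subr0.
  by exists 1; rewrite mul1r subrr; apply: (is_ideal0 idI).
have idJ := ideal_gen_ideal (fun e => I e \/ e = f).
rewrite /ideal_adjoin.
rewrite -(subrK (h * f) g); apply: (is_idealD idJ).
  by apply: ideal_gen_sub; left.
by apply: (is_idealMl _ idJ); apply: ideal_gen_sub; right.
Qed.

Lemma eq_ideal_adjoin I J f g :
  (forall e, I e <-> J e) -> ideal_adjoin I f g <-> ideal_adjoin J f g.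
Proof.
by move=> eqIJ; split=> If K idK sub; apply: If => // e [/eqIJ Ie | ->];
  apply: sub; [left | right | left | right].
Qed.

Definition ideal_span s : S -> Prop := ideal_gen (fun g => g \in s).

Lemma ideal_span_ideal s : is_ideal (ideal_span s).
Proof. exact: ideal_gen_ideal. Qed.
Hint Resolve ideal_span_ideal : core.

Lemma ideal_span_min I s f :
  is_ideal I -> (forall g, g \in s -> I g) -> ideal_span s f -> I f.
Proof. by move=> idI sub; apply. Qed.

Lemma mem_ideal_span s f : f \in s -> ideal_span s f.
Proof. exact: ideal_gen_sub. Qed.

Lemma ideal_span_sub s c f : {subset s <= c} -> ideal_span s f ->
  ideal_span c f.
Proof. by move=> sub; apply: ideal_span_min => // g /sub/mem_ideal_span. Qed.

Lemma ideal_span_cons f s g : ideal_span (f :: s) g <->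
  exists h, ideal_span s (g - h * f).
Proof.
rewrite -(ideal_adjoinP (I := ideal_span s)) //; split=> [|sg].
  apply: ideal_span_min => [|e]; first exact: ideal_gen_ideal.
  by rewrite inE => /predU1P[-> | /mem_ideal_span se] J _; apply;
    [right | left].
apply: sg => // e [|->]; last by apply: mem_ideal_span; rewrite mem_head.
by apply: ideal_span_sub => z zs; rewrite inE zs orbT.
Qed.

Definition nzd I f := forall g, I (g * f) -> I g.

Lemma nzd_mul I f g : nzd I f -> nzd I g -> nzd I (f * g).
Proof. by move=> nf ng h; rewrite mulrA => /ng/nf. Qed.

Lemma nzd_prod I s : (forall f, f \in s -> nzd I f) -> nzd I (\prod_(f <- s) f).
Proof.
elim: s => [|f s IHs] nzs; first by rewrite big_nil => g; rewrite mulr1.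
rewrite big_cons; apply: nzd_mul; first by apply: nzs; rewrite mem_head.
by apply: IHs => g gs; apply: nzs; rewrite inE gs orbT.
Qed.

Lemma nzd_eq s c f : s =i c -> nzd (ideal_span s) f -> nzd (ideal_span c) f.
Proof.
move=> eq_sc nf g cgf; apply: ideal_span_sub (nf g _) => [z|];
  first by rewrite eq_sc.
by apply: ideal_span_sub cgf => z; rewrite eq_sc.
Qed.

(** Multiplication by [a] identifies S/(s, p) with the kernel of the projection
    S/(s, a p) -> S/(s, a); [f] is injective on both ends of this extension,
    hence on its middle term. *)
Lemma nzd_span_mul s a p f :
    nzd (ideal_span s) a -> nzd (ideal_span (a :: s)) f ->
    nzd (ideal_span (p :: s)) f ->
  nzd (ideal_span (a * p :: s)) f.
Proof.
move=> na nfa nfp g /ideal_span_cons[h gfh].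
have /ideal_span_cons[e gea]: ideal_span (a :: s) g.
  by apply: nfa; apply/ideal_span_cons; exists (h * p);
    rewrite -mulrA [p * a]mulrC.
have: ideal_span s ((e * f - h * p) * a).
  suff ->: (e * f - h * p) * a = g * f - h * (a * p) - f * (g - e * a).
    by apply: (is_idealB (ideal_span_ideal _)) => //;
      apply: (is_idealMl _ (ideal_span_ideal _)).
  by ring.
move/na=> efhp; have /ideal_span_cons[d edp]: ideal_span (p :: s) e.
  by apply: nfp; apply/ideal_span_cons; exists h.
apply/ideal_span_cons; exists d.
have ->: g - d * (a * p) = g - e * a + a * (e - d * p) by ring.
by apply: (is_idealD (ideal_span_ideal _)) => //;
  apply: (is_idealMl _ (ideal_span_ideal _)).
Qed.

(** A sequence every permutation of which is weakly regular, in the sense that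
    the quotient of the ring by its elements may vanish; it is stated with
    sublists so as to be inherited by them. *)
Definition permutable_regular s :=
  forall x c d, perm_eq s (x :: c ++ d) -> nzd (ideal_span c) x.

Lemma permutable_regular_perm s c :
  perm_eq s c -> permutable_regular s -> permutable_regular c.
Proof.
by move=> sc regs x c1 c2 cx; apply: (regs x c1 c2); apply: perm_trans cx.
Qed.

Lemma permutable_regular_cons x s :
  permutable_regular (x :: s) -> permutable_regular s.
Proof.
move=> regs y c d sy; apply: (regs y c (x :: d)).
rewrite perm_sym (perm_trans _ (_ : perm_eq (x :: y :: c ++ d) _)) //.
  by rewrite -cat_cons (perm_catCA (y :: c) [:: x] d).
by rewrite perm_cons perm_sym.
Qed.

Definition prods ss := [seq \prod_(f <- s) f | s <- ss].

Definition transversal d ss := all2 (fun f s => f \in s) d ss.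

(** The elements of [c] are kept apart from the products so that the induction
    can move a factor of a product to [c]: [nzd_span_mul] splits off the first
    factor of the first product. *)
Lemma nzd_prods_cat ss c x :
    (forall d, transversal d ss -> permutable_regular (x :: d ++ c)) ->
  nzd (ideal_span (prods ss ++ c)) x.
Proof.
elim: ss c x => [|s ss IHss] c x; first by move/(_ [::] isT x c [::]); apply;
  rewrite cats0.
elim: s => [|a s IHs] regT.
  move=> g _; rewrite /= big_nil; apply/ideal_span_cons; exists g.
  by rewrite mulr1 subrr; apply: (is_ideal0 (ideal_span_ideal _)).
rewrite /= big_cons; apply: nzd_span_mul.
- apply: IHss => d dss; apply: (@permutable_regular_cons x).
  by apply: (regT (a :: d)); rewrite /transversal /= mem_head.
- apply: (@nzd_eq (prods ss ++ a :: c)).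
    by move=> z; rewrite mem_cat !inE mem_cat orbCA.
  apply: IHss => d dss.
  apply: permutable_regular_perm (regT (a :: d) _).
    by rewrite perm_cons cat_cons -cat1s perm_catCA.
  by rewrite /transversal /= mem_head.
apply: IHs => -[|e d] //; rewrite /transversal /= => /andP[es dss].
by apply: (regT (e :: d)); rewrite /transversal /= inE es orbT.
Qed.

(** Products form a regular sequence as soon as all the sequences that consist
    of one factor of each product do. *)
Lemma nzd_prods ss s :
    (forall x d, x \in s -> transversal d ss -> permutable_regular (x :: d)) ->
  nzd (ideal_span (prods ss)) (\prod_(f <- s) f).
Proof.
move=> regT; apply: nzd_prod => x xs; rewrite -(cats0 (prods ss)).
by apply: nzd_prods_cat => d dss; rewrite cats0; apply: regT.
Qed.

(** The intersection of the ideals (c, p b) is (c, product of the p b) when the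
    p b are pairwise independent: if f = h (p b) modulo [c] also lies in the
    ideal of the product of the other factors, then so does h. *)
Lemma ideal_span_bigprod (T : eqType) (p : T -> S) (s : seq T) c f :
    uniq s ->
    (forall b (s' : seq T), b \in s -> {subset s' <= s} -> b \notin s' ->
       nzd (ideal_span (\prod_(z <- s') p z :: c)) (p b)) ->
    (forall b, b \in s -> ideal_span (p b :: c) f) ->
  ideal_span (\prod_(z <- s) p z :: c) f.
Proof.
elim: s => [|b s IHs] /=.
  by move=> *; apply/ideal_span_cons; exists f; rewrite big_nil mulr1 subrr;
    apply: (is_ideal0 (ideal_span_ideal _)).
case/andP=> bs us nz sf; rewrite big_cons.
have /ideal_span_cons[h fh]: ideal_span (p b :: c) f by apply: sf;
  rewrite mem_head.
have sub: {subset s <= b :: s} by move=> z zs; rewrite inE zs orbT.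
have sfs: ideal_span (\prod_(z <- s) p z :: c) f.
  apply: IHs => // [z s' zs subs | z zs]; last by apply: sf; apply: sub.
  by apply: nz; [apply: sub | move=> y /subs/sub].
have /ideal_span_cons[e he]: ideal_span (\prod_(z <- s) p z :: c) h.
  apply: (nz b s) => //; first by rewrite mem_head.
  rewrite -[h * p b](subKr f); apply: (is_idealB (ideal_span_ideal _)) => //.
  by apply: ideal_span_sub fh => z zc; rewrite inE zc orbT.
apply/ideal_span_cons; exists e.
have ->: f - e * (p b * \prod_(z <- s) p z)
         = f - h * p b + p b * (h - e * \prod_(z <- s) p z) by ring.
by apply: (is_idealD (ideal_span_ideal _)) => //;
  apply: (is_idealMl _ (ideal_span_ideal _)).
Qed.

Section Grid.

Variables (T U : eqType).
Implicit Types (rows : seq T) (cols : seq U).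

(** The factors of the product of the powers g b ^+ n b, as a list: the
    transversals of [nzd_prods] pick their elements from it. *)
Definition powers (V : Type) (g : V -> S) (n : V -> nat) (s : seq V) : seq S :=
  flatten [seq nseq (n b) (g b) | b <- s].

Lemma prod_powers (V : Type) (g : V -> S) n (s : seq V) :
  \prod_(f <- powers g n s) f = \prod_(b <- s) g b ^+ n b.
Proof.
rewrite big_flatten big_map; apply: eq_bigr => b _.
by rewrite big_nseq -Monoid.iteropE.
Qed.

Lemma powersP (V : eqType) (g : V -> S) n (s : seq V) f :
  f \in powers g n s -> exists2 b, b \in s & f = g b.
Proof.
case/flattenP=> _ /mapP[b bs ->] /nseqP[-> _].
by exists b.
Qed.

(** The ideal of a grid whose point (a, b) has the nonreduced structure
    (g a, h b ^+ n b) is a complete intersection.  The columns are intersected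
    first, along each row, and then the rows. *)
Lemma ideal_span_grid (g : T -> S) (h : U -> S) (n : U -> nat) rows cols f :
    uniq rows -> uniq cols ->
    (forall a b b', a \in rows -> b \in cols -> b' \in cols -> b != b' ->
       permutable_regular [:: h b; h b'; g a]) ->
    (forall a a' b, a \in rows -> a' \in rows -> b \in cols -> a != a' ->
       permutable_regular [:: g a; g a'; h b]) ->
    (forall a b, a \in rows -> b \in cols ->
       ideal_span [:: h b ^+ n b; g a] f) ->
  ideal_span [:: \prod_(a <- rows) g a; \prod_(b <- cols) h b ^+ n b] f.
Proof.
move=> urows ucols regU regT sf.
apply: ideal_span_bigprod => // [a s' a_r sub as' | a a_r].
  have := @nzd_prods [:: [seq g a' | a' <- s']; powers h n cols] [:: g a].
  rewrite /= big_map prod_powers big_seq1; apply.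
  move=> x [|y [|z [|? ?]]] //;
    rewrite inE /transversal /= ?andbF ?andbT // => /eqP->.
  case/andP=> /mapP[c cs' ->] /powersP[b b_c ->]; apply: regT => //.
    exact: sub.
  by apply: contraNneq as' => ->.
apply: (@ideal_span_sub [:: \prod_(b <- cols) h b ^+ n b; g a]).
  by move=> z; rewrite !inE orbC.
apply: ideal_span_bigprod => // [b s' b_c sub bs' | b b_c]; last exact: sf.
have := @nzd_prods [:: powers h n s'; [:: g a]] (nseq (n b) (h b)).
rewrite /= prod_powers big_nseq -Monoid.iteropE big_seq1; apply.
move=> x [|y [|z [|? ?]]] //;
  rewrite /transversal /= ?andbF ?andbT // => /nseqP[-> _].
rewrite inE => /andP[/powersP[d ds' ->] /eqP->]; apply: regU => //.
  exact: sub.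
by apply: contraNneq bs' => ->.
Qed.

End Grid.

(** With A, U, B, V the four products, (A, V) and (B, U) meet inside
    (U V, A, B).  If f = p A + q V lies in (B, U), then q V lies in (A, U, B),
    and so does q because V is a nonzerodivisor modulo A, U, B; the term of q
    in U is the multiple h. *)
Lemma ideal_span_corner sA sU sB sV f :
    (forall a u b v, a \in sA -> u \in sU -> b \in sB -> v \in sV ->
       permutable_regular [:: v; a; u; b]) ->
    ideal_span (prods [:: sA; sV]) f -> ideal_span (prods [:: sB; sU]) f ->
  exists h, ideal_span (prods [:: sA; sB])
                 (f - h * (\prod_(u <- sU) u * \prod_(v <- sV) v)).
Proof.
move=> reg; have := @nzd_prods [:: sA; sU; sB] sV; rewrite /prods /=.
set A := \prod_(a <- sA) a; set U := \prod_(a <- sU) a.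
set B := \prod_(a <- sB) a; set V := \prod_(a <- sV) a => nzV.
case/ideal_span_cons=> p /ideal_span_cons[q fpq] fBU.
have span0 e : ideal_span [::] e -> e = 0.
  by apply: (@ideal_span_min (fun e => e = 0)) => //;
    split=> // [? ? -> -> | ? ? ->];
    rewrite ?addr0 ?mulr0.
have{fpq} def_f: f = p * A + q * V.
  by move/span0/eqP: fpq; rewrite -addrA -opprD subr_eq0 => /eqP.
have: ideal_span [:: A; U; B] q.
  apply: nzV => [x [|a [|u [|b [|? ?]]]] |];
    rewrite ?/(transversal _ _) /= ?andbF ?andbT //.
    by move=> xV /and3P[aA uU bB]; apply: reg.
  have ->: q * V = f - p * A by rewrite def_f; ring.
  apply: (is_idealB (ideal_span_ideal _)) => //;
    last by apply: (is_idealMl _ (ideal_span_ideal _)) => //;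
    apply: mem_ideal_span; rewrite mem_head.
  by apply: ideal_span_sub fBU => z; rewrite !inE => /orP[]->; rewrite ?orbT.
case/ideal_span_cons=> p' /ideal_span_cons[h /ideal_span_cons[s' /span0/eqP]].
rewrite subr_eq add0r => /eqP def_q.
exists h; apply/ideal_span_cons; exists (p + p' * V); apply/ideal_span_cons;
  exists (s' * V).
have def_q': q = s' * B + h * U + p' * A by rewrite -def_q; ring.
have ->: f - h * (U * V) - (p + p' * V) * A - s' * V * B = 0.
  by rewrite def_f def_q'; ring.
exact: is_ideal0.
Qed.

End IdealTheory.

(** * Linear forms *)

Section LinearForms.

Import GRing.Theory.
Local Open Scope ring_scope.

Variables (k : fieldType) (n : nat).
Implicit Types (p q : {mpoly k[n]}) (u v : 'rV[k]_n) (w : 'cV[k]_n).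

Definition linear_form v : {mpoly k[n]} := \sum_i v 0 i *: 'X_i.

Lemma linear_formE v w : (linear_form v).@[fun i => w i 0] = (v *m w) 0 0.
Proof.
rewrite /linear_form raddf_sum mxE; apply: eq_bigr => i _ /=.
by rewrite mevalZ mevalXU.
Qed.

Lemma linear_form_is_linear : linear linear_form.
Proof.
move=> a u v; rewrite /linear_form scaler_sumr -big_split /=.
by apply: eq_bigr => i _; rewrite !mxE scalerDl scalerA.
Qed.

HB.instance Definition _ :=
  GRing.isLinear.Build k 'rV[k]_n {mpoly k[n]} _ linear_form
    linear_form_is_linear.

Lemma linear_form_inj : injective linear_form.
Proof.
apply: raddf_inj => v v0; apply/rowP=> i; rewrite mxE.
have := linear_formE v (delta_mx i 0); rewrite v0 meval0 mxE => ->.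
rewrite (bigD1 i) //= mxE !eqxx mulr1 big1 ?addr0 // => j ji.
by rewrite mxE (negPf ji) mulr0.
Qed.

Lemma linear_form_delta i : linear_form (delta_mx 0 i) = 'X_i.
Proof.
rewrite /linear_form (bigD1 i) //= mxE !eqxx scale1r big1 ?addr0 // => j ji.
by rewrite mxE (negPf ji) scale0r.
Qed.

(** A substitution that moves each variable within its class modulo [I] moves
    every polynomial within its class. *)
Lemma subst_ideal (I : {mpoly k[n]} -> Prop) (h : n.-tuple {mpoly k[n]}) :
    is_ideal I -> (forall i, I ('X_i - tnth h i)) ->
  forall p, I (p - (p \mPo h)).
Proof.
move=> idI Ih p.
have subM (f g : {mpoly k[n]}) : I (f - (f \mPo h)) -> I (g - (g \mPo h)) ->
    I (f * g - ((f * g) \mPo h)).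
  move=> If Ig; rewrite rmorphM /=.
  rewrite (_ : _ - _ = g * (f - (f \mPo h)) + (f \mPo h) * (g - (g \mPo h))).
    by apply: (is_idealD idI); apply: (is_idealMl _ idI).
  by ring.
rewrite [p]mpolyE; elim/big_rec: _ => [|m q _ Iq].
  by rewrite raddf0 subr0; apply: is_ideal0.
rewrite raddfD /= opprD addrACA; apply: (is_idealD idI) => //.
rewrite comp_mpolyZ -scalerBr -mul_mpolyC; apply: (is_idealMl _ idI).
rewrite mpolyXE_id; elim/big_rec: _ => [|i g _ Ig].
  by rewrite rmorph1 subrr; apply: is_ideal0.
apply: (subM) => //; elim: (m i) => [|e IHe].
  by rewrite rmorph1 subrr; apply: is_ideal0.
rewrite exprS; apply: subM => //.
by rewrite comp_mpolyXU -tnth_nth.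
Qed.

(** A linear projection P of k^n along the span of [us] induces a ring
    endomorphism of the polynomial ring whose kernel is the ideal of the forms
    of [us].  That ideal is therefore prime, and it does not contain the form
    of [v], since [w] separates [v] from the span of [us]. *)
Lemma nzd_linear_form (us : seq 'rV[k]_n) v w :
    (forall u, u \in us -> u *m w = 0) -> v *m w != 0 ->
  nzd (ideal_span (map linear_form us)) (linear_form v).
Proof.
move=> us_w v_w; set I := ideal_span _;
  have idI: is_ideal I by apply: ideal_span_ideal.
pose A := \matrix_(i < size us) us`_i.
have A_w: A *m w = 0.
  by apply/row_matrixP=> i; rewrite row_mul rowK row0 us_w ?mem_nth.
(* u *m pinvmx A *m A = u on the row space of A, so P is zero there, while
   1 - P takes its values in the row space. *)
pose P := 1%:M - pinvmx A *m A.
pose h := [tuple linear_form (row i P) | i < n].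
have comp_h u : linear_form u \mPo h = linear_form (u *m P).
  rewrite mulmx_sum_row !raddf_sum; apply: eq_bigr => i _ /=.
  by rewrite comp_mpolyZ comp_mpolyXU -tnth_nth tnth_mktuple linearZ.
have I_comp: forall p, I (p - (p \mPo h)).
  apply: subst_ideal => // i; rewrite tnth_mktuple -linear_form_delta -raddfB.
  rewrite -row1 -[row i _ - _]linearB /P subKr /= row_mul mulmx_sum_row
    raddf_sum.
  elim/big_ind: _ => [|f g|j _]; [exact: is_ideal0 | exact: is_idealD |].
  rewrite /= linearZ /= -mul_mpolyC; apply: (is_idealMl _ idI).
  by apply: mem_ideal_span; rewrite rowK map_f ?mem_nth.
have comp0 p : I p -> p \mPo h = 0.
  apply: (@ideal_span_min _ (fun q => q \mPo h = 0)) => [|_ /mapP[u us_u ->]].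
    split=> [|f g f0 g0 | f g g0]; first exact: raddf0.
      by rewrite raddfD /= f0 g0 addr0.
    by rewrite rmorphM /= g0 mulr0.
  suff: u *m P = 0 by rewrite comp_h => ->; apply: raddf0.
  rewrite mulmxBr mulmx1 mulmxA mulmxKpV ?subrr //.
  have /(nthP 0)[i i_us <-] := us_u.
  by rewrite (_ : us`_i = row (Ordinal i_us) A) ?row_sub // rowK.
move=> g /comp0/eqP; rewrite rmorphM mulf_eq0 /= => /orP[/eqP g0 | ].
  by rewrite -[g]subr0 -g0.
rewrite comp_h raddf_eq0; last exact: linear_form_inj.
rewrite mulmxBr mulmx1 subr_eq0 => /eqP def_v.
by move: v_w; rewrite def_v !mulmxA -[_ *m w]mulmxA A_w mulmx0 eqxx.
Qed.

End LinearForms.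

Section RegularLinearForms.
Import GRing.Theory.
Local Open Scope ring_scope.

(** The condition is linear independence, in the form of a dual family. *)
Lemma permutable_regular_linear (k : fieldType) (n : nat) (vs : seq 'rV[k]_n) :
    uniq vs ->
    (forall v, v \in vs -> exists w : 'cV[k]_n,
       v *m w != 0 /\ forall u, u \in vs -> u != v -> u *m w = 0) ->
  permutable_regular (map (@linear_form k n) vs).
Proof.
move=> uvs dual x c d vs_xcd.
have: x \in map (@linear_form k n) vs.
  by rewrite (perm_mem vs_xcd) mem_head.
case/mapP=> v v_vs def_x; have [w [v_w vs_w]] := dual v v_vs.
have: uniq (x :: c ++ d).
  by rewrite -(perm_uniq vs_xcd) (map_inj_uniq (@linear_form_inj _ _)).
rewrite /= mem_cat negb_or -andbA => /and3P[xc _ _].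
pose us := [seq u <- vs | linear_form u \in c].
apply: (@nzd_eq _ (map (@linear_form k n) us)) => [z|].
  apply/mapP/idP=> [[u] | zc]; first by rewrite mem_filter => /andP[uc _] ->.
  have: z \in map (@linear_form k n) vs.
    by rewrite (perm_mem vs_xcd) inE mem_cat zc orbT.
  by case/mapP=> u u_vs def_z; exists u; rewrite // mem_filter -def_z zc.
rewrite def_x; apply: nzd_linear_form v_w => u.
rewrite mem_filter => /andP[uc u_vs]; apply: vs_w => //.
by apply: contraNneq xc => uv; rewrite def_x -uv.
Qed.

End RegularLinearForms.

Section Lines.
Import GRing.Theory.
Local Open Scope ring_scope.
Variable k : fieldType.

(** [xrow u] and [yrow u] hold the coefficients of [LR] and [LQ] at [u]; the
    linear form of [xrow u] vanishes at the vector [xcol u], which represents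
    the same point as [u], and that of every [yrow] vanishes there too. *)
Definition xrow (u : k * k) : 'rV[k]_4 := \row_i [:: u.2; - u.1; 0; 0]`_i.
Definition yrow (u : k * k) : 'rV[k]_4 := \row_i [:: 0; 0; u.2; - u.1]`_i.
Definition xcol (u : k * k) : 'cV[k]_4 := \col_i [:: u.1; u.2; 0; 0]`_i.
Definition ycol (u : k * k) : 'cV[k]_4 := \col_i [:: 0; 0; u.1; u.2]`_i.

Lemma LR_linear_form (R : pline k) : LR R = linear_form (xrow (repr R)).
Proof.
rewrite /LR /x0 /x1 /linear_form !big_ord_recl big_ord0 !mxE /= !scale0r !addr0
  scaleNr.
by congr (_ *: 'X_ _ - _ *: 'X_ _); apply: val_inj.
Qed.

Lemma LQ_linear_form (Q : pline k) : LQ Q = linear_form (yrow (repr Q)).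
Proof.
rewrite /LQ /y0 /y1 /linear_form !big_ord_recl big_ord0 !mxE /= !scale0r !add0r
  addr0 scaleNr.
by congr (_ *: 'X_ _ - _ *: 'X_ _); apply: val_inj.
Qed.

Lemma xrow_xcol u v : xrow u *m xcol v = (u.2 * v.1 - u.1 * v.2)%:M.
Proof.
apply/matrixP=> i j; rewrite !ord1 !mxE !big_ord_recl big_ord0 !mxE /=.
by rewrite !mulr0 !addr0 mulNr mulr1n.
Qed.

Lemma yrow_ycol u v : yrow u *m ycol v = (u.2 * v.1 - u.1 * v.2)%:M.
Proof.
apply/matrixP=> i j; rewrite !ord1 !mxE !big_ord_recl big_ord0 !mxE /=.
by rewrite !mul0r !add0r addr0 mulNr mulr1n.
Qed.

Lemma xrow_ycol u v : xrow u *m ycol v = 0.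
Proof.
apply/matrixP=> i j; rewrite !mxE !big_ord_recl big_ord0 !mxE /=.
by rewrite !(mulr0, mul0r) !addr0.
Qed.

Lemma yrow_xcol u v : yrow u *m xcol v = 0.
Proof.
apply/matrixP=> i j; rewrite !mxE !big_ord_recl big_ord0 !mxE /=.
by rewrite !(mulr0, mul0r) !addr0.
Qed.

(** The value of [LR a] at the representative of [c]. *)
Definition pline_det (a c : pline k) : k :=
  (repr a).2 * (repr c).1 - (repr a).1 * (repr c).2.

Lemma pline_det_neq0 a c : a != c -> pline_det a c != 0.
Proof.
apply: contraNneq => /eqP; rewrite subr_eq0 => /eqP ac.
rewrite -[a]reprK -[c]reprK; apply/eqP/eqmodP.
by rewrite /= /proportional ac mulrC.
Qed.

(** The dual family consists of the other point in each of the two factors: the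
    representative of [c] is a zero of [LR c] but not of [LR a]. *)
Lemma permutable_regular_lines (a c b d : pline k) :
  a != c -> b != d -> permutable_regular [:: LR a; LR c; LQ b; LQ d].
Proof.
have sub0 u : u.2 * u.1 - u.1 * u.2 = 0 :> k by ring.
move=> ac bd; rewrite !LR_linear_form !LQ_linear_form.
pose vs := [:: xrow (repr a); xrow (repr c); yrow (repr b); yrow (repr d)].
pose ws := [:: xcol (repr c); xcol (repr a); ycol (repr d); ycol (repr b)].
have dual : forall i j, (i < 4)%N -> (j < 4)%N ->
    (vs`_i *m ws`_j == 0) = (i != j).
  have nz1 (z : k) : z != 0 -> ((z%:M : 'M_1) == 0) = false.
    by apply: contraNF => /eqP/matrixP/(_ 0 0); rewrite !mxE mulr1n => ->.
  have ca: c != a by rewrite eq_sym.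
  have db: d != b by rewrite eq_sym.
  move=> [|[|[|[|i]]]] [|[|[|[|j]]]] //= _ _;
  rewrite ?xrow_xcol ?yrow_ycol ?xrow_ycol ?yrow_xcol ?sub0 ?raddf0 ?eqxx //;
  by apply: nz1; apply: pline_det_neq0.
have uvs : uniq vs.
  apply/(uniqP 0) => i j i4 j4 ij; apply/eqP; rewrite -[_ == _]negbK -dual //.
  by rewrite ij dual // eqxx.
apply: (@permutable_regular_linear k 4 vs) => // v /(nthP 0)[i i4 <-].
exists ws`_i; split; first by rewrite dual // eqxx.
move=> u /(nthP 0)[j j4 <-]; rewrite nth_uniq // => ji.
by apply/eqP; rewrite dual.
Qed.

End Lines.

(** * Powers of ideals and ideals of points *)

Section IdealPowers.
Import GRing.Theory.
Local Open Scope ring_scope.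
Variable S : comNzRingType.
Implicit Types (I J : S -> Prop) (f g h : S).

Lemma ideal_exp_ideal I n : is_ideal (ideal_exp I n).
Proof. by case: n => [|n]; [split | apply: ideal_gen_ideal]. Qed.

Lemma ideal_exp_leq I n n' f : (n <= n')%N -> ideal_exp I n' f ->
  ideal_exp I n f.
Proof.
move=> /subnK<-; elim: (n' - n)%N => [|d IHd] //= If; apply: IHd.
apply: If => [|_ [g [h [_ Ih ->]]]]; first exact: ideal_exp_ideal.
by apply: is_idealMl Ih; apply: ideal_exp_ideal.
Qed.

Lemma ideal_exp1 I f : is_ideal I -> ideal_exp I 1 f <-> I f.
Proof.
move=> idI; split=> [If | If].
  by apply: (If I) => // _ [g [h [Ig _ ->]]]; apply: (is_idealMr _ idI).
by apply: ideal_gen_sub; exists f, 1; rewrite mulr1.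
Qed.

Lemma ideal_exp_mul_pow I n n' f g :
  I f -> ideal_exp I n g -> ideal_exp I (n' + n) (f ^+ n' * g).
Proof.
move=> If Ig; elim: n' => [|n' IHn]; first by rewrite mul1r.
by rewrite exprS -mulrA addSn; apply: ideal_gen_sub; exists f, (f ^+ n' * g).
Qed.

(** Modulo [f] the n-th power of (f, g) is generated by [g ^+ n]. *)
Lemma ideal_exp_span2 n f g h :
  ideal_exp (ideal_span [:: f; g]) n h -> ideal_span [:: g ^+ n; f] h.
Proof.
elim: n h => [|n IHn] h.
  move=> _; apply/ideal_span_cons; exists h; rewrite mulr1 subrr.
  by apply: is_ideal0; apply: ideal_span_ideal.
apply=> [|_ [p [q [sp /IHn sq ->]]]]; first exact: ideal_span_ideal.
have /ideal_span_cons[b pb]: ideal_span [:: g; f] p.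
  by apply: ideal_span_sub sp => z; rewrite !inE orbC.
have /ideal_span_cons[d qd] := sq; apply/ideal_span_cons; exists (b * d).
have ->: p * q - b * d * g ^+ n.+1
       = q * (p - b * g) + b * g * (q - d * g ^+ n) by rewrite exprS; ring.
by apply: (is_idealD (ideal_span_ideal _));
  apply: (is_idealMl _ (ideal_span_ideal _)).
Qed.

End IdealPowers.

Section PointIdeals.
Import GRing.Theory.
Local Open Scope ring_scope.
Variable k : fieldType.

Lemma point_ideal_ideal (P : point k) : is_ideal (point_ideal P).
Proof. exact: ideal_gen_ideal. Qed.

Lemma point_idealE (P : point k) f :
  point_ideal P f <-> ideal_span [:: LR P.1; LQ P.2] f.
Proof.
by split=> If I idI sub; apply: If => // g; last rewrite !inE;
  [move=> gP; apply: sub; rewrite !inE; case: gP => ->; rewrite eqxx ?orbT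
  | case/orP=> /eqP gP; apply: sub; [left | right]].
Qed.

Lemma ideal_exp_point n R Q (f : coordring k) :
  ideal_exp (point_ideal (R, Q)) n f ->
  ideal_span [:: LQ Q ^+ n; LR R] f /\ ideal_span [:: LR R ^+ n; LQ Q] f.
Proof.
suff sub I J : (forall g, I g -> J g) ->
  forall g : coordring k, ideal_exp I n g -> ideal_exp J n g.
  move=> If; split; apply: ideal_exp_span2; apply: sub If => g.
    by move/point_idealE.
  by move/point_idealE; apply: ideal_span_sub => z; rewrite !inE orbC.
move=> subIJ; elim: n => [|n IHn] g //=; apply=> [|_ [p [q [Ip Iq ->]]]].
  exact: ideal_gen_ideal.
by apply: ideal_gen_sub; exists p, q; split; auto.
Qed.

End PointIdeals.

(** * Adjoining the form of a corner *)

Section CornerStep.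
Import GRing.Theory.
Local Open Scope ring_scope.
Variables (k : fieldType) (r t : nat).
Variables (R : 'I_r -> pline k) (Q : 'I_t -> pline k).
Hypotheses (R_inj : injective R) (Q_inj : injective Q).
Implicit Types (m M : 'M[nat]_(r, t)) (a : 'I_r) (b : 'I_t) (f g : coordring k).

(** The ideal of the scheme with multiplicity m a b at the point R_a x Q_b; a
    point of multiplicity 0 imposes no condition. *)
Definition grid_ideal m f : Prop :=
  forall a b, ideal_exp (point_ideal (R a, Q b)) (m a b) f.

Lemma grid_ideal_ideal m : is_ideal (grid_ideal m).
Proof.
split=> [a b | f g If Ig a b | f g Ig a b];
  have idI := ideal_exp_ideal (point_ideal (R a, Q b)) (m a b).
- exact: is_ideal0.
- exact: is_idealD.
exact: is_idealMl.
Qed.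

Variables (m M : 'M[nat]_(r, t)) (i : 'I_r) (j : 'I_t).

(** How the corner (i, j) sits with respect to the multiplicities [m] left by
    the previous corners and to the degree matrix [M], whose entries are the
    exponents in the form of the corner: [block_prod] makes the points of
    multiplicity 1 below and to the right of the corner a grid, and
    [block_left], [block_above] compare the exponents with the multiplicities
    of the points that lie in the rows and in the columns of this grid. *)
Record corner_step : Prop := CornerStep {
  corner_row_gt0 : (0 < i)%N;
  corner_col_gt0 : (0 < j)%N;
  block_prod : forall (a : 'I_r) (b : 'I_t), (i <= a)%N -> (j <= b)%N ->
    m a b = ((m a j != 0%N) && (m i b != 0%N)) :> nat;
  block_left : forall (a : 'I_r) (b : 'I_t), (i <= a)%N -> (b < j)%N ->
    m a j != 0%N -> (M i b <= m a b)%N;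
  block_above : forall (a : 'I_r) (b : 'I_t), (a < i)%N -> (j <= b)%N ->
    m i b != 0%N -> (M a j <= m a b)%N;
  corner_order : forall (a : 'I_r) (b : 'I_t), ~~ ((i <= a) && (j <= b))%N ->
    (m a b <= (a < i) * M a j + (b < j) * M i b)%N
}.

Hypothesis stepP : corner_step.

Definition block_rows : seq 'I_r :=
  [seq a : 'I_r <- enum 'I_r | (i <= a)%N && (m a j != 0%N)].
Definition block_cols : seq 'I_t :=
  [seq b : 'I_t <- enum 'I_t | (j <= b)%N && (m i b != 0%N)].

Local Notation F := (corner_form R Q M (i, j)).

Lemma mem_block_rows a : (a \in block_rows) = (i <= a)%N && (m a j != 0%N).
Proof. by rewrite mem_filter mem_enum andbT. Qed.

Lemma mem_block_cols b : (b \in block_cols) = (j <= b)%N && (m i b != 0%N).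
Proof. by rewrite mem_filter mem_enum andbT. Qed.

Lemma grid_regular a a' b b' : a != a' -> b != b' ->
  permutable_regular [:: LR (R a); LR (R a'); LQ (Q b); LQ (Q b')].
Proof.
by move=> aa' bb'; apply: permutable_regular_lines; rewrite inj_eq.
Qed.

(* The factors of the forms A, B, U, V: A and B cut out the block, and U V is
   the form of the corner. *)
Let sA := [seq LR (R a) | a <- block_rows].
Let sB := [seq LQ (Q b) | b <- block_cols].
Let rowsU := [seq a : 'I_r <- enum 'I_r | (a < i)%N].
Let colsV := [seq b : 'I_t <- enum 'I_t | (b < j)%N].
Let sU := powers (fun a => LR (R a)) (M ^~ j) rowsU.
Let sV := powers (fun b => LQ (Q b)) (M i) colsV.

Lemma corner_formE : F = \prod_(u <- sU) u * \prod_(v <- sV) v.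
Proof.
rewrite !prod_powers /corner_form /rowsU /colsV !big_filter /=.
by rewrite !big_enum_cond.
Qed.

Lemma corner_form_order a b :
  ideal_exp (point_ideal (R a, Q b)) ((a < i) * M a j + (b < j) * M i b) F.
Proof.
have prodD (T : finType) (P : pred T) (g : T -> coordring k) n c :
    exists h, \prod_(z | P z) g z ^+ n z = g c ^+ (P c * n c) * h.
  case Pc: (P c); last by exists (\prod_(z | P z) g z ^+ n z); rewrite mul1r.
  by rewrite (bigD1 c) // mul1n;
    exists (\prod_(z | P z && (z != c)) g z ^+ n z).
rewrite /corner_form /=.
have [h1 ->] := prodD _ (fun a : 'I_r => (a < i)%N)
  (fun a => LR (R a)) (M ^~ j) a.
have [h2 ->] := prodD _ (fun b : 'I_t => (b < j)%N) (fun b => LQ (Q b)) (M i) b.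
rewrite mulrACA mulrC; apply: (is_idealMl _ (ideal_exp_ideal _ _)).
(* The empty product stands for the zeroth power of the ideal. *)
rewrite -[((b < j) * _)%N]addn0 -[LQ _ ^+ _]mulr1 {2}addn0.
by apply: ideal_exp_mul_pow; [|apply: ideal_exp_mul_pow] => //;
  apply: ideal_gen_sub; [left | right].
Qed.

Lemma corner_form_zero_from : grid_ideal (zero_from m (i, j)) F.
Proof.
move=> a b; rewrite mxE /=; case: ifPn => // /(corner_order stepP).
by move/ideal_exp_leq; apply; apply: corner_form_order.
Qed.

Let i0 : 'I_r := Ordinal (leq_ltn_trans (leq0n i) (ltn_ord i)).
Let j0 : 'I_t := Ordinal (leq_ltn_trans (leq0n j) (ltn_ord j)).

(** The corner is neither in the first row nor in the first column, so there is
    always a fourth line that completes three lines to a basis of the linear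
    forms. *)
Lemma grid_regular_rows a a' b : a != a' ->
  permutable_regular [:: LR (R a); LR (R a'); LQ (Q b)].
Proof.
move=> aa'; have [b' bb']: exists b', b != b'.
  have [-> | bj] := eqVneq b j; last by exists j.
  by exists j0; rewrite -val_eqE /= -lt0n; apply: corner_col_gt0 stepP.
apply: (@permutable_regular_cons _ (LQ (Q b'))).
apply: permutable_regular_perm (grid_regular aa' bb').
by apply/permP=> p /=; ring.
Qed.

Lemma grid_regular_cols a b b' : b != b' ->
  permutable_regular [:: LQ (Q b); LQ (Q b'); LR (R a)].
Proof.
move=> bb'; have [a' aa']: exists a', a != a'.
  have [-> | ai] := eqVneq a i; last by exists i.
  by exists i0; rewrite -val_eqE /= -lt0n; apply: corner_row_gt0 stepP.
apply: (@permutable_regular_cons _ (LR (R a'))).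
apply: permutable_regular_perm (grid_regular aa' bb').
by apply/permP=> p /=; ring.
Qed.

Lemma nzd_corner_form a b : a \in block_rows -> b \in block_cols ->
  nzd (point_ideal (R a, Q b)) F.
Proof.
rewrite mem_block_rows mem_block_cols =>
  /andP[ia _] /andP[jb _] g /point_idealE.
move=> gF; apply/point_idealE; move: g gF.
suff: nzd (ideal_span [:: LR (R a); LQ (Q b)]) F by [].
have:= @nzd_prods _ [:: [:: LR (R a)]; [:: LQ (Q b)]].
rewrite /prods /= !big_seq1 => nz.
rewrite corner_formE; apply: nzd_mul; apply: nz => x [|y [|z [|? ?]]];
  rewrite /transversal /= ?andbF ?andbT // !inE => + /andP[/eqP-> /eqP->].
  case/powersP=> a'; rewrite mem_filter => /andP[a'i _] ->.
  by apply: grid_regular_rows; rewrite -val_eqE neq_ltn (leq_trans a'i ia).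
case/powersP=> b'; rewrite mem_filter => /andP[b'j _] ->.
apply: permutable_regular_perm (@grid_regular_cols a b' b _).
  by apply/permP=> p /=; ring.
by rewrite -val_eqE neq_ltn (leq_trans b'j jb).
Qed.

Lemma block_mult a b : (i <= a)%N -> (j <= b)%N ->
  m a b = ((a \in block_rows) && (b \in block_cols)) :> nat.
Proof.
move=> ia jb; rewrite mem_block_rows mem_block_cols ia jb /=.
exact: block_prod.
Qed.

(** Outside the block the form of the corner already vanishes to the required
    order; on the block, multiplicities are 1 and it is a nonzerodivisor modulo
    the ideal of each point. *)
Lemma colon_corner f :
  ideal_colon (grid_ideal m) F f <->
  forall a b, a \in block_rows -> b \in block_cols -> point_ideal (R a, Q b) f.
Proof.
split=> [fF a b a_in b_in | f_in a b].
  have [] := (mem_block_rows a, mem_block_cols b); rewrite a_in b_in.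
  move=> /esym/andP[ia _] /esym/andP[jb _].
  have := fF a b; rewrite block_mult // a_in b_in /=.
  move/(ideal_exp1 _ (point_ideal_ideal _)); exact: nzd_corner_form.
have [/andP[ia jb] | out] := boolP ((i <= a) && (j <= b))%N.
  rewrite block_mult //; case: andP => // -[a_in b_in].
  apply/(ideal_exp1 _ (point_ideal_ideal _)).
  by apply: (is_idealMr _ (point_ideal_ideal _)); apply: f_in.
apply: (is_idealMl _ (ideal_exp_ideal _ _)).
apply: ideal_exp_leq (corner_form_order a b); exact: corner_order.
Qed.

(** On a row of the block, a form of the ideal vanishes at the points to the
    left of the corner to the orders given by the exponents of the corner
    form. *)
Lemma grid_ideal_left f : grid_ideal (zero_from m (i, j)) f ->
  ideal_span [:: \prod_(a <- block_rows) LR (R a);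
           \prod_(b <- colsV) LQ (Q b) ^+ M i b] f.
Proof.
move=> If.
apply: (@ideal_span_grid _ _ _ (fun a => LR (R a)) (fun b => LQ (Q b)) (M i)).
- exact/filter_uniq/enum_uniq.
- exact/filter_uniq/enum_uniq.
- by move=> a b b' _ _ _; apply: grid_regular_cols.
- by move=> a a' b _ _ _; apply: grid_regular_rows.
move=> a b; rewrite mem_block_rows mem_filter => /andP[ia ma] /andP[bj _].
have := If a b; rewrite mxE /= [(j <= b)%N]leqNgt bj andbF.
by move/(ideal_exp_leq (block_left stepP ia bj ma))/ideal_exp_point=> [].
Qed.

Lemma grid_ideal_above f : grid_ideal (zero_from m (i, j)) f ->
  ideal_span [:: \prod_(b <- block_cols) LQ (Q b);
           \prod_(a <- rowsU) LR (R a) ^+ M a j] f.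
Proof.
move=> If.
apply: (@ideal_span_grid _ _ _ (fun b => LQ (Q b))
  (fun a => LR (R a)) (M ^~ j)).
- exact/filter_uniq/enum_uniq.
- exact/filter_uniq/enum_uniq.
- by move=> b a a' _ _ _; apply: grid_regular_rows.
- by move=> b b' a _ _ _; apply: grid_regular_cols.
move=> b a; rewrite mem_block_cols mem_filter => /andP[jb mb] /andP[ai _].
have := If a b; rewrite mxE /= [(i <= a)%N]leqNgt ai.
by move/(ideal_exp_leq (block_above stepP ai jb mb))/ideal_exp_point=> [].
Qed.

(** Adjoining the form of the corner frees exactly the points of the block: [f]
    is corrected by a multiple of it so as to vanish on the block, and the other
    conditions persist because the form of the corner satisfies them. *)
Lemma adjoin_corner f :
  ideal_adjoin (grid_ideal m) F f <-> grid_ideal (zero_from m (i, j)) f.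
Proof.
have idm := grid_ideal_ideal m;
  have idz := grid_ideal_ideal (zero_from m (i, j)).
rewrite ideal_adjoinP //; split=> [[h Ih] | If].
  rewrite -(subrK (h * F) f); apply: (is_idealD idz); last first.
    by apply: (is_idealMl _ idz); apply: corner_form_zero_from.
  by move=> a b; rewrite mxE /=; case: ifP.
have [|||h fF] := @ideal_span_corner _ sA sU sB sV f.
- move=> _ _ _ _ /mapP[a + ->] /powersP[a' + ->] /mapP[b + ->]
    /powersP[b' + ->].
  rewrite mem_block_rows mem_block_cols !mem_filter.
  move=> /andP[ia _] /andP[a'i _] /andP[jb _] /andP[b'j _].
  apply: permutable_regular_perm (@grid_regular a' a b' b _ _).
  + by apply/permP=> p /=; ring.
  + by rewrite -val_eqE neq_ltn (leq_trans a'i ia).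
  by rewrite -val_eqE neq_ltn (leq_trans b'j jb).
- by rewrite /prods /= !big_map prod_powers; apply: grid_ideal_left.
- by rewrite /prods /= !big_map prod_powers; apply: grid_ideal_above.
exists h; move: fF; rewrite -corner_formE => fF a b.
have [/andP[ia jb] | out] := boolP ((i <= a) && (j <= b))%N.
  rewrite block_mult //; case: andP => // -[a_in b_in].
  apply/(ideal_exp1 _ (point_ideal_ideal _)).
  apply: ideal_span_min fF => [|e]; first exact: point_ideal_ideal.
  have idP := point_ideal_ideal (R a, Q b).
  rewrite !inE => /orP[] /eqP->; rewrite big_map.
    rewrite (big_rem _ a_in) /=; apply: (is_idealMr _ idP).
    by apply: ideal_gen_sub; left.
  rewrite (big_rem _ b_in) /=; apply: (is_idealMr _ idP).
  by apply: ideal_gen_sub; right.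
have: grid_ideal (zero_from m (i, j)) (f - h * F).
  by apply: (is_idealB idz) => //; apply: (is_idealMl _ idz);
    apply: corner_form_zero_from.
by move/(_ a b); rewrite mxE /= (negPf out).
Qed.

End CornerStep.

(** * Corners of a partition *)

Lemma mem_take_sorted (T : eqType) (leT : rel T) (s : seq T) n x y :
    transitive leT -> antisymmetric leT -> sorted leT s -> uniq s ->
    onth s n = Some x ->
  (y \in take n s) = [&& y \in s, leT y x & y != x].
Proof.
move=> tr anti srt us nx; have n_s: n < size s by rewrite -onthTE nx.
have [ys | ys] /= := boolP (y \in s); last first.
  by apply: contraNF ys; apply: mem_take.
have x_n: index x s = n by rewrite -[x in LHS](onth_nth x _ _ _ nx) index_uniq.
have xs: x \in s by rewrite -index_mem x_n.
rewrite in_take // -x_n; apply/idP/andP=> [yx | [yx neq]].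
  split; first exact: (sorted_ltn_index tr srt).
  by apply: contraTneq yx => ->; rewrite ltnn.
rewrite ltnNge leq_eqVlt negb_or; apply/andP; split.
  by apply: contraNneq neq => /index_inj->.
apply: contraNN neq => xy; apply/eqP/anti; rewrite yx.
exact: (sorted_ltn_index tr srt).
Qed.

Section Lex.
Variables r t : nat.
Implicit Types c d : 'I_r * 'I_t.

Lemma lex_geq_trans : transitive (@lex_geq r t).
Proof. by move=> [a b] [c d] [e f]; rewrite /lex_geq -!val_eqE /=; lia. Qed.

Lemma lex_geq_total : total (@lex_geq r t).
Proof. by move=> [a b] [c d]; rewrite /lex_geq -!val_eqE /=; lia. Qed.

Lemma lex_geq_anti : antisymmetric (@lex_geq r t).
Proof.
move=> [a b] [c d]; rewrite /lex_geq -!val_eqE /= => cmp.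
by congr pair; apply: val_inj => /=; lia.
Qed.

Lemma corner_mxE (M : 'M[nat]_(r, t)) l a b :
  corner_mx M l a b =
  if has (fun c => (c.1 <= a) && (c.2 <= b)) (take l (corner_seq M)) then 0
  else M a b.
Proof.
rewrite /corner_mx; elim/last_ind: (take _ _) => [|s c IHs] //.
by rewrite foldl_rcons has_rcons mxE IHs; case: ifP.
Qed.

Lemma corner_mxS (M : 'M[nat]_(r, t)) l c :
  onth (corner_seq M) l = Some c ->
    corner_mx M l.+1 = zero_from (corner_mx M l) c.
Proof.
move=> lc; have l_s: l < size (corner_seq M) by rewrite -onthTE lc.
by rewrite /corner_mx (take_nth c) // foldl_rcons (onth_nth c _ _ _ lc).
Qed.

(** The corners are listed without repetition and in decreasing order, so the
    ones before a given corner are the lexicographically larger ones. *)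
Lemma mem_take_corner_seq (M : 'M[nat]_(r, t)) l c d :
    onth (corner_seq M) l = Some c ->
  (d \in take l (corner_seq M)) =
  (d \in base_corners M :|: derived_corners M) &&
    ((c.1 < d.1) || (c.1 == d.1) && (c.2 < d.2)).
Proof.
move=> lc; rewrite (mem_take_sorted _ lex_geq_trans lex_geq_anti _ _ lc).
- rewrite mem_sort mem_enum; congr (_ && _).
  case: c d {lc} => [a b] [a' b']; rewrite /lex_geq xpair_eqE -!val_eqE /=.
  by lia.
- exact/sort_sorted/lex_geq_total.
by rewrite sort_uniq enum_uniq.
Qed.

End Lex.

Section Partition.

Variable lam : seq nat.
Hypotheses (lam_sorted : sorted geq lam) (lam_gt0 : 0 \notin lam).

Local Notation r := (size lam).
Local Notation t := (head 0 lam).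
Local Notation M := (degree_mx lam).
Local Notation part := (nth 0 lam).

Lemma part_nonincr a b : a <= b -> part b <= part a.
Proof.
move=> ab; have [b_r | /(nth_default 0)-> //] := ltnP b r.
have geq_trans: transitive geq by move=> x y z; lia.
exact: (sorted_leq_nth geq_trans leqnn 0 lam_sorted a b (leq_ltn_trans ab b_r)
  b_r ab).
Qed.

Lemma part_gt0 a : a < r -> 0 < part a.
Proof.
by move=> a_r; rewrite lt0n; apply: contraNneq lam_gt0 => <-; apply: mem_nth.
Qed.

Lemma degree_mxE (a : 'I_r) (b : 'I_t) : M a b = if b < part a then 2 else 1.
Proof. by rewrite mxE. Qed.

(** The rows of the base corners; the base corner in row a is (a, part a). *)
Definition descent a := (0 < a) && (part a < part a.-1).

Lemma descentP a b : a <= b -> part b < part a ->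
  exists c, [/\ a < c, c <= b, descent c & part c = part b].
Proof.
elim: b => [|b IHb]; first by case: a => // _; rewrite ltnn.
rewrite leq_eqVlt => /predU1P[-> | ab]; first by rewrite ltnn.
have [eq_b | neq_b] := eqVneq (part b.+1) (part b).
  rewrite eq_b => /(IHb ab)[c [ac cb dc part_c]].
  by exists c; split=> //; apply: leqW.
exists b.+1; split=> //.
by rewrite /descent /= ltn_neqAle neq_b part_nonincr.
Qed.

Lemma mem_base_corners (c : 'I_r * 'I_t) :
  (c \in base_corners M) = descent c.1 && (c.2 == part c.1 :> nat).
Proof.
case: c => a b; rewrite inE /= /descent degree_mxE.
apply/idP/idP => [/and3P[Mab /existsP[a' /andP[/eqP aa' +]]] | ].
  move=> + /existsP[b' /andP[/eqP bb' +]]; rewrite !degree_mxE -aa' /=.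
  by do 2?[case: ifP => //]; move: Mab; rewrite -aa'; case: ifP => //; lia.
case/andP=> /andP[a0 drop] /eqP b_part.
have a'_r: a.-1 < r by rewrite (leq_ltn_trans (leq_pred a)).
have b'_t: b.-1 < t by rewrite (leq_ltn_trans (leq_pred b)).
have part_a := part_gt0 (ltn_ord a).
apply/and3P; split; first by rewrite b_part ltnn.
  by apply/existsP; exists (Ordinal a'_r);
    rewrite degree_mxE /= prednK // b_part drop !eqxx.
apply/existsP; exists (Ordinal b'_t); rewrite degree_mxE /=.
have -> : b.-1 < part a by rewrite b_part ltn_predL.
by rewrite prednK ?eqxx // b_part.
Qed.

(** The corners are the pairs (e, part e') with e' <= e two descents; e' = e
    for the base corners and e' < e for the derived ones. *)
Lemma corners_subset (c : 'I_r * 'I_t) :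
    c \in base_corners M :|: derived_corners M ->
  descent c.1 /\ exists2 e, e <= c.1 & descent e /\ c.2 = part e :> nat.
Proof.
rewrite inE => /orP[|/imset2P[c1 c2]].
  by rewrite mem_base_corners => /andP[d1 /eqP c2]; split=> //; exists c.1.
rewrite mem_base_corners => /andP[d1 _]; rewrite in_set mem_base_corners.
by case/andP=> /andP[d2 /eqP e2] lt21 -> /=; split=> //; exists c2.1;
  rewrite // ltnW.
Qed.

Lemma corners_exist e e' : e < r -> e' <= e -> descent e -> descent e' ->
  exists c : 'I_r * 'I_t, [/\ c \in base_corners M :|: derived_corners M,
    c.1 = e :> nat & c.2 = part e' :> nat].
Proof.
move=> e_r e'e de de'.
have descent_t a : descent a -> part a < t.
  by case/andP=> _ /leq_trans-> //; rewrite -nth0 part_nonincr.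
pose c0 := (Ordinal e_r, Ordinal (descent_t _ de')).
pose c1 := (Ordinal e_r, Ordinal (descent_t _ de)).
pose c2 := (Ordinal (leq_ltn_trans e'e e_r), Ordinal (descent_t _ de')).
exists c0; split=> //; rewrite inE.
have := e'e; rewrite leq_eqVlt => /predU1P[eq_e' | lt_e'].
  by rewrite mem_base_corners /= de eq_e' eqxx.
apply/orP; right; apply/imset2P; exists c1 c2 => //.
  by rewrite mem_base_corners /= de eqxx.
by rewrite in_set mem_base_corners /= de' eqxx.
Qed.

Variables (l : nat) (i : 'I_r) (j : 'I_t).
Hypothesis l_corner : onth (corner_seq M) l = Some (i, j).
Local Notation m := (corner_mx M l).
Implicit Types (a : 'I_r) (b : 'I_t).

Lemma corner_mx_eq0 a b :
  reflect (exists e e', [/\ [/\ e < r, e' <= e, descent e & descent e'],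
             (i < e) || (i == e :> nat) && (j < part e'),
               e <= a & part e' <= b])
          (m a b == 0).
Proof.
have M_neq0: M a b != 0 by rewrite degree_mxE; case: ifP.
rewrite corner_mxE; set zeroed := has _ _.
have ->: ((if zeroed then 0 else M a b) == 0) = zeroed.
  by case: zeroed => //; apply: negbTE.
apply: (iffP hasP) => [[c] | [e [e' [[e_r e'e de de'] later ea e'b]]]].
  rewrite (mem_take_corner_seq _ l_corner) =>
    /andP[/corners_subset[d1 [e ee [de c2]]]].
  move=> /= later /andP[c1a c2b]; exists c.1, e; rewrite -c2.
  by rewrite c1a c2b ltn_ord; split.
have [c [c_in c1 c2]] := corners_exist e_r e'e de de'.
exists c; last by rewrite c1 c2 ea.
by rewrite (mem_take_corner_seq _ l_corner) c_in -val_eqE /= c1 c2.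
Qed.

Lemma corner_mx_neq0 a b : m a b != 0 -> m a b = M a b.
Proof. by rewrite corner_mxE; case: ifP. Qed.

Lemma corner_mx_le a b : m a b <= M a b.
Proof. by rewrite corner_mxE; case: ifP. Qed.

Lemma corner_indices :
  descent i /\ exists2 e, e <= i & descent e /\ j = part e :> nat.
Proof.
apply: (@corners_subset (i, j)).
have: (i, j) \in corner_seq M by apply/onthP; exists l.
by rewrite mem_sort mem_enum.
Qed.

Lemma corner_mx_corner : m i j != 0.
Proof.
apply/negP=> /corner_mx_eq0[e [e' [_ later ei e'j]]]; lia.
Qed.

(** The corners that precede (i, j) lie either further right in row i or in a
    row below i.  With each of the latter comes the base corner of its row,
    which is to the left of (i, j); hence a point of the quadrant of (i, j) is
    freed by a corner of row i, which only depends on its column, or by a base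
    corner of a lower row, which only depends on its row. *)
Lemma corner_mx_step : corner_step m M i j.
Proof.
have [d_i [e0 e0i [d0 def_j]]] := corner_indices.
have part_ij: part i <= j by rewrite def_j part_nonincr.
have up (a a' : 'I_r) (b b' : 'I_t) : a <= a' -> b <= b' -> m a b == 0 ->
  m a' b' == 0.
  move=> aa' bb' /corner_mx_eq0[e [e' [? ? ea e'b]]]; apply/corner_mx_eq0.
  by exists e, e'; split; rewrite // ?(leq_trans ea) ?(leq_trans e'b).
split.
- by case/andP: d_i.
- by rewrite def_j; apply: part_gt0; apply: leq_ltn_trans e0i _.
- move=> a b ia jb; have M1: M a b = 1.
    by rewrite degree_mxE ltnNge (leq_trans _ jb) // (leq_trans _ part_ij)
      ?part_nonincr.
  have [m0 | m_neq0] := eqVneq (m a b) 0.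
    rewrite m0; apply/esym/eqP; rewrite eqb0 negb_and !negbK.
    move/eqP: m0 => /corner_mx_eq0[e [e' [[e_r e'e de de'] later ea e'b]]].
    case/orP: later => [ie | /andP[/eqP ie je']].
      apply/orP; left; apply/corner_mx_eq0; exists e, e; split; rewrite ?ie //.
      exact: leq_trans (part_nonincr (ltnW ie)) part_ij.
    apply/orP; right; apply/corner_mx_eq0; exists e, e'.
    by split; rewrite // ie ?eqxx ?je' ?orbT.
  rewrite corner_mx_neq0 // M1.
  by rewrite (contraNneq _ m_neq0) ?(contraNneq _ m_neq0) // => /eqP m0;
    apply: up m0.
- move=> a b ia bj maj.
  (* Otherwise a base corner between the rows i and a frees (a, j). *)
  have part_a: part a = part i.
    apply/eqP; rewrite eqn_leq part_nonincr //= leqNgt; apply: contraNN maj.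
    case/(descentP ia)=> e [ie ea de part_e]; apply/corner_mx_eq0.
    exists e, e; split; rewrite ?ie //.
      by split=> //; apply: leq_ltn_trans ea _.
    exact: leq_trans (part_nonincr (ltnW ie)) part_ij.
  have mab: m a b != 0 by apply: contraNN maj; apply: up => //; apply: ltnW.
  by rewrite corner_mx_neq0 // !degree_mxE part_a.
- move=> a b ai jb mib.
  have mab: m a b != 0.
    by apply/negP=> /corner_mx_eq0[e [e' [_ later ea _]]]; lia.
  rewrite corner_mx_neq0 // !degree_mxE; case: ifP => ja; last by case: ifP.
  (* If part a <= b, the row a ends at the column of a base corner above row i,
     and the derived corner of row i in this column frees (i, b). *)
  have [//|a_b] := ltnP b (part a).
  have [|e [_ ea de part_e]] := @descentP 0 a (leq0n a).
    by rewrite nth0; apply: leq_ltn_trans a_b _.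
  case/negP: mib; apply/corner_mx_eq0; exists i, e; rewrite part_e eqxx ja orbT.
  by split=> //; split=> //; rewrite (leq_trans ea) // ltnW.
move=> a b out; have := corner_mx_le a b.
rewrite !degree_mxE; move: out; rewrite negb_and -!ltnNge.
have := part_nonincr; move: part_ij.
case: (ltnP a i) => ai; case: (ltnP b j) => bj //= part_ij mono _;
  rewrite ?mul0n ?mul1n ?addn0 ?add0n.
- by move/leq_trans; apply; do 3!case: ifP.
- by move/leq_trans; apply; do 2!case: ifP => //; lia.
move/leq_trans; apply; have := mono _ _ ai.
by do 2!case: ifP => //; lia.
Qed.

End Partition.

(** * The ideals of the corners *)

Lemma alpha_sorted (k : fieldType) (X : {fset point k}) : sorted geq (alpha X).
Proof. by apply: sort_sorted => a b; apply: leq_total. Qed.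

Lemma alpha_gt0 (k : fieldType) (X : {fset point k}) : 0 \notin alpha X.
Proof.
rewrite mem_sort; apply/mapP=> -[A /imfsetP[P /= P_X ->]] /esym/eqP.
rewrite cardfs_eq0 => /eqP/fsetP/(_ P).
by rewrite !inE /= P_X eqxx.
Qed.

Section Main.
Local Open Scope fset_scope.
Variables (k : fieldType) (Z : fat_points k) (lam : seq nat).
Variables (R : 'I_(size lam) -> pline k) (Q : 'I_(head 0 lam) -> pline k).
Hypothesis Z_double : double_points Z.
Hypotheses (lam_sorted : sorted geq lam) (lam_gt0 : 0 \notin lam).
Hypothesis RQ_labelling : ferrers_labelling (finsupp Z) R Q.
Local Notation M := (degree_mx lam).

Let R_inj : injective R. Proof. by case: RQ_labelling => -[]. Qed.
Let Q_inj : injective Q. Proof. by case: RQ_labelling => _ []. Qed.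

Lemma mem_labelling a b : ((R a, Q b) \in finsupp Z) = (b < nth 0 lam a).
Proof.
case: RQ_labelling => _ _ inX; apply/idP/idP=> [/inX[a' [b' [ab' eqP']]] | ab].
  by case: eqP' => /R_inj-> /Q_inj->.
by apply/inX; exists a, b.
Qed.

Lemma completion_label a b : completion Z (R a, Q b) = M a b.
Proof.
case: RQ_labelling => -[_ inR] [_ inQ] _.
have Ra: R a \in pi1 (finsupp Z) by apply/inR; exists a.
have Qb: Q b \in pi2 (finsupp Z) by apply/inQ; exists b.
rewrite fsfunE in_fsetM /= Ra Qb /= mem_labelling mxE; case: ifP => // ab.
by rewrite Z_double // mem_labelling.
Qed.

Lemma fat_ideal_completion f : fat_ideal (completion Z) f <->
  grid_ideal R Q M f.
Proof.
split=> [If a b | If P].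
  have := If (R a, Q b); rewrite mem_finsupp completion_label; apply.
  by rewrite mxE; case: ifP.
move=> P_in; have: P \in pi1 (finsupp Z) `*` pi2 (finsupp Z).
  by apply: contraTT P_in => /negPf P_out;
    rewrite mem_finsupp fsfunE P_out eqxx.
case: P {P_in} => A B; rewrite in_fsetM => /andP[/= A_in B_in].
case: RQ_labelling => -[_ inR] [_ inQ] _.
have [a ->] := (inR A).1 A_in; have [b ->] := (inQ B).1 B_in.
by rewrite completion_label.
Qed.

(** The ideals obtained by adjoining the corner forms to the ideal of the
    completion are ideals of fat points; each step is [adjoin_corner]. *)
Lemma corner_idealE l f : l <= size (corner_seq M) ->
  corner_ideal R Q M (fat_ideal (completion Z)) l f <->
  grid_ideal R Q (corner_mx M l) f.
Proof.
elim: l f => [|l IHl] f l_s.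
  by rewrite /corner_ideal /corner_mx take0; apply: fat_ideal_completion.
case def_c: (onth (corner_seq M) l) => [[i j]|]; last first.
  by move: l_s; rewrite -onthTE def_c.
rewrite (corner_mxS def_c) /corner_ideal (take_nth (i, j)) // foldl_rcons.
rewrite (onth_nth (i, j) _ _ _ def_c).
have := adjoin_corner R_inj Q_inj (corner_mx_step lam_sorted lam_gt0 def_c) f.
move=> <-; apply: eq_ideal_adjoin => e; apply: IHl; exact: ltnW.
Qed.

End Main.

Lemma product_is_CI (k : fieldType) (A B : seq (pline k)) :
    uniq A -> uniq B -> A != [::] -> B != [::] ->
  is_CI ([fset x in A] `*` [fset x in B])%fset (size A) (size B).
Proof.
move=> uA uB A_n0 B_n0; set C := (_ `*` _)%fset.
have [a a_A]: exists a, a \in A by case: A A_n0 {uA C} => // a s _; exists a;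
  apply: mem_head.
have [b b_B]: exists b, b \in B by case: B B_n0 {uB C} => // b s _; exists b;
  apply: mem_head.
have pi1C: pi1 C = [fset x in A]%fset.
  apply/fsetP=> x; apply/imfsetP/idP=> [[P + ->] | x_A];
    first by rewrite in_fsetM => /andP[].
  by exists (x, b) => //=; rewrite in_fsetM x_A !inE.
have pi2C: pi2 C = [fset x in B]%fset.
  apply/fsetP=> x; apply/imfsetP/idP=> [[P + ->] | x_B];
    first by rewrite in_fsetM => /andP[].
  by exists (a, x) => //=; rewrite in_fsetM x_B !inE a_A.
by rewrite /is_CI pi1C pi2C !card_fseq !undup_id.
Qed.

Lemma sum_block_rows r t (m M : 'M[nat]_(r, t)) i j :
  corner_step m M i j -> m i j != 0 ->
  \sum_(u < r | i <= u) m u j = size (block_rows m i j).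
Proof.
move=> step mij; rewrite -sum1_size big_filter big_enum_cond /= big_mkcondr.
by apply: eq_bigr => u iu; rewrite (block_prod step) // mij andbT; case: eqP.
Qed.

Lemma sum_block_cols r t (m M : 'M[nat]_(r, t)) i j :
  corner_step m M i j -> m i j != 0 ->
  \sum_(v < t | j <= v) m i v = size (block_cols m i j).
Proof.
move=> step mij; rewrite -sum1_size big_filter big_enum_cond /= big_mkcondr.
by apply: eq_bigr => v jv; rewrite (block_prod step) // mij /=; case: eqP.
Qed.

Theorem lemma4p3 (k : closedFieldType) (char0 : [pchar k]%R =i pred0)
  (Z : fat_points k) (Z_double : double_points Z) (X_ACM : ACM (finsupp Z))
  (lam : seq nat) (lamE : lam = alpha (finsupp Z))
  (R : 'I_(size lam) -> pline k) (Q : 'I_(head 0 lam) -> pline k)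
  (RQ_labelling : ferrers_labelling (finsupp Z) R Q)
  (ell : nat)
  (ell_range : 1 <= ell <= size (corner_seq (degree_mx lam)))
  (i : 'I_(size lam)) (j : 'I_(head 0 lam))
  (ij_corner : onth (corner_seq (degree_mx lam)) ell.-1 = Some (i, j)) :
  let M := degree_mx lam in
  let I_prev := corner_ideal R Q M (fat_ideal (completion Z)) ell.-1 in
  let m := corner_mx M ell.-1 in
  let a := \sum_(u < size lam | i <= u) m u j in
  let b := \sum_(v < head 0 lam | j <= v) m i v in
  exists C : {fset point k},
    is_CI C a b /\
    forall f : coordring k,
      ideal_colon I_prev (corner_form R Q M (i, j)) f <-> points_ideal C f.
Proof.
move=> M I_prev m a b.
have lam_sorted: sorted geq lam by rewrite lamE alpha_sorted.
have lam_gt0: 0 \notin lam by rewrite lamE alpha_gt0.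
have [[R_inj _] [Q_inj _] _] := RQ_labelling.
have step := corner_mx_step lam_sorted lam_gt0 ij_corner.
have mij := corner_mx_corner lam_sorted lam_gt0 ij_corner.
pose rows := block_rows m i j; pose cols := block_cols m i j.
have i_rows: i \in rows by rewrite mem_block_rows leqnn.
have j_cols: j \in cols by rewrite mem_block_cols leqnn.
exists ([fset x in map R rows] `*` [fset x in map Q cols])%fset; split.
  rewrite /a /b (sum_block_rows step mij) (sum_block_cols step mij).
  rewrite -(size_map R) -(size_map Q); apply: product_is_CI.
  - by rewrite map_inj_uniq // filter_uniq // enum_uniq.
  - by rewrite map_inj_uniq // filter_uniq // enum_uniq.
  - by apply: contraTneq (map_f R i_rows) => ->.
  - by apply: contraTneq (map_f Q j_cols) => ->.
have ell_s: ell.-1 <= size (corner_seq M).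
  by case/andP: ell_range => _; apply: leq_trans (leq_pred _).
move=> f; rewrite /ideal_colon /I_prev corner_idealE //.
rewrite -/(ideal_colon _ _ f) colon_corner //;
  split=> [If P | If u v u_in v_in].
  case: P => A B; rewrite in_fsetM !inE =>
    /andP[/mapP[u u_in /= ->] /mapP[v v_in /= ->]].
  exact: If.
by apply: If; rewrite in_fsetM !inE /=; apply/andP; split; apply: map_f.
Qed.
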